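(* Let $\mathbb K$ be $\mathbb R$ or $\mathbb C$ and let $\mathfrak g=\mathrm{sl}(2,\mathbb K)$. Then all Nijenhuis eigenbases of $\mathfrak g$ are equivalent: for any two Nijenhuis eigenbases $\zeta_1,\zeta_2,\zeta_3$ and $\zeta_1',\zeta_2',\zeta_3'$ of $\mathfrak g$ there exist non-zero constants $\mu_1,\mu_2,\mu_3\in\mathbb K$ and a Lie algebra automorphism $\Phi:\mathfrak g\to\mathfrak g$ such that $\zeta_i'=\mu_i\Phi(\zeta_i)$ for $i=1,2,3$.
   Context: A Nijenhuis eigenbasis of a finite-dimensional Lie algebra $\mathfrak g$ is a basis $\zeta_1,\dots,\zeta_n$ of $\mathfrak g$ such that $[\zeta_i,\zeta_j]$ lies in the linear span of $\zeta_i$ and $\zeta_j$ for all $i,j$. Here $\mathrm{sl}(2,\mathbb K)$ is the Lie algebra of traceless $2\times 2$ matrices over $\mathbb K$. *)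

(* Defs.v *)
From HB Require Import structures.
From mathcomp Require Import all_boot all_order all_algebra.
From mathcomp Require Import ring.
From mathcomp Require Import reals complex.

Set Implicit Arguments.
Unset Strict Implicit.
Unset Printing Implicit Defensive.

Import GRing.Theory.
Local Open Scope ring_scope.

HB.mixin Record Vector_isLieAlgebra (K : fieldType) L of Vector K L := {
  lie : L -> L -> L;
  lie_linearl : forall y, linear (fun x => lie x y);
  lie_linearr : forall x, linear (lie x);
  liexx : forall x, lie x x = 0;
  lie_jacobi : forall x y z,
    lie x (lie y z) + lie y (lie z x) + lie z (lie x y) = 0
}.

#[short(type="lieAlgType")]
HB.structure Definition LieAlgebra (K : fieldType) :=
  { L of Vector K L & Vector_isLieAlgebra K L }.

Section LieAlgebraNotions.
Variables (K : fieldType) (g : lieAlgType K).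

Definition lie_automorphism (Phi : 'End(g)) : Prop :=
  bijective Phi /\ forall x y : g, Phi (lie x y) = lie (Phi x) (Phi y).

(* [basis_of fullv zeta] forces n to be the dimension of g. *)
Definition nijenhuis_eigenbasis (n : nat) (zeta : n.-tuple g) : Prop :=
  basis_of fullv zeta /\
  forall i j : 'I_n,
    lie (tnth zeta i) (tnth zeta j) \in <<[:: tnth zeta i; tnth zeta j]>>%VS.

Definition equivalent_eigenbases (n : nat) (zeta zeta' : n.-tuple g) : Prop :=
  exists (mu : 'I_n -> K) (Phi : 'End(g)),
    [/\ forall i, mu i != 0,
        lie_automorphism Phi
      & forall i, tnth zeta' i = mu i *: Phi (tnth zeta i)].

End LieAlgebraNotions.

Section SpecialLinear.
Variables (n : nat) (K : fieldType).

Definition traceless : {vspace 'M[K]_n} :=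
  lker (linfun (mxtrace : 'M[K]_n -> K^o)).

Lemma mem_traceless (A : 'M[K]_n) : (A \in traceless) = (\tr A == 0).
Proof. by rewrite memv_ker lfunE. Qed.

Definition mxcomm (A B : 'M[K]_n) : 'M[K]_n := A *m B - B *m A.

Lemma mxcomm_traceless (A B : 'M[K]_n) : mxcomm A B \in traceless.
Proof. by rewrite mem_traceless /mxcomm raddfB /= mxtrace_mulC subrr. Qed.

Definition sl : Type := subvs_of traceless.

HB.instance Definition _ := Vector.copy sl (subvs_of traceless).

Definition sl_lie (x y : sl) : sl :=
  Subvs (mxcomm_traceless (vsval x) (vsval y)).

Lemma val_sl_lie (x y : sl) : vsval (sl_lie x y) = mxcomm (vsval x) (vsval y).
Proof. by []. Qed.

Lemma mxcommC (A B : 'M[K]_n) : mxcomm A B = - mxcomm B A.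
Proof. by rewrite /mxcomm opprB. Qed.

Lemma mxcomm_linearr (A : 'M[K]_n) : linear (mxcomm A).
Proof.
move=> a B C; rewrite /mxcomm mulmxDr mulmxDl -scalemxAr -scalemxAl.
by rewrite scalerBr opprD addrACA.
Qed.

Lemma sl_lie_linearr (x : sl) : linear (sl_lie x).
Proof. by move=> a u v; apply: val_inj; apply: mxcomm_linearr. Qed.

Lemma sl_lie_linearl (y : sl) : linear (fun x => sl_lie x y).
Proof.
move=> a u v; apply: val_inj => /=.
rewrite mxcommC [mxcomm (vsval u) _]mxcommC [mxcomm (vsval v) _]mxcommC.
by rewrite scalerN -opprD; congr (- _); apply: mxcomm_linearr.
Qed.

Lemma sl_liexx (x : sl) : sl_lie x x = 0.
Proof. by apply: val_inj; apply: subrr. Qed.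

Lemma mxcomm_jacobi (A B C : 'M[K]_n) :
  mxcomm A (mxcomm B C) + mxcomm B (mxcomm C A) + mxcomm C (mxcomm A B) = 0.
Proof.
rewrite /mxcomm !mulmxBr !mulmxBl !mulmxA !opprB.
apply/matrixP => i j; rewrite !mxE; ring.
Qed.

Lemma sl_lie_jacobi (x y z : sl) :
  sl_lie x (sl_lie y z) + sl_lie y (sl_lie z x) + sl_lie z (sl_lie x y) = 0.
Proof. by apply: val_inj; apply: mxcomm_jacobi. Qed.

HB.instance Definition _ := Vector_isLieAlgebra.Build K sl
  sl_lie_linearl sl_lie_linearr sl_liexx sl_lie_jacobi.

End SpecialLinear.

(* Main.v *)
(** An eigenbasis satisfies [z_i, z_(i+1)] = a_i z_i + b_i z_(i+1), the indices
    being taken modulo 3, and Jacobi's identity reads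
    a_i a_(i+1) = b_(i+1) b_(i+2).  Because sl(2) is perfect, every linear form
    vanishing on all brackets is zero.  Applied to z |-> tr (ad z), this gives
    a_i = b_(i+1), so that a single sequence m := b describes the whole bracket:
    [z_i, z_(i+1)] = m_(i+1) z_i + m_i z_(i+1).  Perfectness again forces every
    m_i to be nonzero.  The vectors z_i / m_i then satisfy
    [w_i, w_(i+1)] = w_i + w_(i+1), so any two eigenbases, rescaled in this way,
    have the same structure constants. *)

Require Import Defs.
From HB Require Import structures.
From mathcomp Require Import all_boot all_order all_algebra.
From mathcomp Require Import ring.
From mathcomp Require Import reals complex.

Set Implicit Arguments.
Unset Strict Implicit.
Unset Printing Implicit Defensive.

Import GRing.Theory Num.Theory.
Local Open Scope ring_scope.

(** * Brackets in coordinates and linear maps given on a basis *)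

Section LieTheory.
Variables (K : fieldType) (g : lieAlgType K).
Implicit Types x y : g.

HB.instance Definition _ x :=
  GRing.isLinear.Build K g g *:%R (lie x) (lie_linearr x).

(** The arguments are swapped so that linearity in the first variable can be registered as a
    canonical linear map. *)
Definition lier y x := lie x y.

HB.instance Definition _ y :=
  GRing.isLinear.Build K g g *:%R (lier y) (lie_linearl y).

Lemma lieDl x1 x2 y : lie (x1 + x2) y = lie x1 y + lie x2 y.
Proof. exact: (linearD (lier y)). Qed.

Lemma lieZl (a : K) x y : lie (a *: x) y = a *: lie x y.
Proof. exact: (linearZ_LR (lier y)). Qed.

Lemma lie_suml I (r : seq I) (F : I -> g) y :
  lie (\sum_(i <- r) F i) y = \sum_(i <- r) lie (F i) y.
Proof. exact: (linear_sum (lier y)). Qed.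

Lemma lieC x y : lie x y = - lie y x.
Proof.
apply/eqP; rewrite -addr_eq0; apply/eqP.
by have := liexx (x + y); rewrite lieDl !linearD /= !liexx add0r addr0.
Qed.

Lemma coord_basisE n (z : n.-tuple g) x :
  basis_of fullv z -> x = \sum_i coord z i x *: tnth z i.
Proof.
move=> zb; rewrite [LHS](coord_basis zb (memvf x)).
by apply: eq_bigr => i _; rewrite (tnth_nth 0).
Qed.

Lemma coord_tnth n (z : n.-tuple g) i j :
  basis_of fullv z -> coord z i (tnth z j) = (j == i)%:R.
Proof.
by move=> zb; rewrite (tnth_nth 0) coord_free ?(basis_free zb).
Qed.

Lemma lie_coordE n (z : n.-tuple g) x y : basis_of fullv z ->
  lie x y = \sum_i \sum_j
    (coord z i x * coord z j y) *: lie (tnth z i) (tnth z j).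
Proof.
move=> zb; rewrite {1}(coord_basisE x zb) lie_suml; apply: eq_bigr => i _.
rewrite lieZl {1}(coord_basisE y zb) linear_sum scaler_sumr.
by apply: eq_bigr => j _; rewrite linearZ scalerA.
Qed.

Lemma lie_morph_on_basis n (z : n.-tuple g) (f : {linear g -> g}) :
  basis_of fullv z ->
  (forall i j, f (lie (tnth z i) (tnth z j)) =
               lie (f (tnth z i)) (f (tnth z j))) ->
  forall x y, f (lie x y) = lie (f x) (f y).
Proof.
move=> zb fz x y; rewrite (lie_coordE x y zb).
rewrite [in RHS](coord_basisE x zb) [in RHS](coord_basisE y zb).
rewrite !(linear_sum f) lie_suml; apply: eq_bigr => i _; rewrite !linear_sum /=.
by apply: eq_bigr => j _; rewrite !linearZ /= lieZl fz scalerA mulrC.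
Qed.

Section BasisMap.
Variables (n : nat) (z : n.-tuple g) (w : 'I_n -> g).

Definition basis_map_fun x : g := \sum_i coord z i x *: w i.

Fact basis_map_fun_is_linear : linear basis_map_fun.
Proof.
move=> a x y; rewrite /basis_map_fun scaler_sumr -big_split /=.
by apply: eq_bigr => i _; rewrite linearP scalerDl scalerA.
Qed.

HB.instance Definition _ :=
  GRing.isLinear.Build K g g *:%R basis_map_fun basis_map_fun_is_linear.

Definition basis_map : 'End(g) := linfun basis_map_fun.

Lemma basis_map_tnth i : basis_of fullv z -> basis_map (tnth z i) = w i.
Proof.
move=> zb; rewrite lfunE /= /basis_map_fun (bigD1 i) //= coord_tnth //.
rewrite eqxx scale1r big1 ?addr0 // => j ji.
by rewrite coord_tnth // eq_sym (negPf ji) scale0r.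
Qed.

End BasisMap.

Lemma basis_mapK n (z z' : n.-tuple g) (nu mu : 'I_n -> K) :
    basis_of fullv z -> basis_of fullv z' -> (forall i, nu i * mu i = 1) ->
  cancel (basis_map z (fun i => nu i *: tnth z' i))
         (basis_map z' (fun i => mu i *: tnth z i)).
Proof.
move=> zb z'b numu x; rewrite [in LHS](coord_basisE x zb) !linear_sum.
rewrite [RHS](coord_basisE x zb); apply: eq_bigr => i _.
rewrite !linearZ /= basis_map_tnth // linearZ /= basis_map_tnth //.
by rewrite (scalerA (nu i)) numu scale1r.
Qed.

(** Dual form of [g, g] = g: in finite dimension, a proper subspace is annihilated by some non-zero
    linear form. *)
Definition perfect :=
  forall phi : {linear g -> K^o},
    (forall x y, phi (lie x y) = 0) -> forall x, phi x = 0.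

End LieTheory.

(** * Cyclic arithmetic of three indices *)

Lemma ord3D1 (i : 'I_3) : i + 1 + 1 + 1 = i.
Proof. by apply/eqP; case: i => [[|[|[|]]]]. Qed.

Lemma ord3D1_neq (i : 'I_3) : i + 1 != i.
Proof. by case: i => [[|[|[|]]]]. Qed.

Lemma ord3D2_neq (i : 'I_3) : i + 1 + 1 != i.
Proof. by case: i => [[|[|[|]]]]. Qed.

Lemma ord3_cases (i j : 'I_3) : [|| j == i, j == i + 1 | j == i + 1 + 1].
Proof. by case: i j => [[|[|[|]]] ?] // [[|[|[|]]] ?]. Qed.

(** Modulo 3, [j = i + 2] means [i = j + 1], so distinct indices are cyclic neighbours in one of the
    two orders. *)
Lemma ord3_pair_ind (P : 'I_3 -> 'I_3 -> Prop) :
  (forall i, P i i) -> (forall i j, P i j -> P j i) ->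
  (forall i, P i (i + 1)) -> forall i j, P i j.
Proof.
move=> Pd Ps P1 i j; case/or3P: (ord3_cases i j) => /eqP-> //.
by apply: Ps; rewrite -{2}(ord3D1 i).
Qed.

Section CyclicSign.
Variable K : fieldType.

(** This is the Levi-Civita symbol summed over its third index; it lets a single formula give the
    bracket of any two basis vectors. *)
Definition cyc_sign (i j : 'I_3) : K := (j == i + 1)%:R - (i == j + 1)%:R.

Lemma cyc_sign_refl i : cyc_sign i i = 0.
Proof. exact: subrr. Qed.

Lemma cyc_signC i j : cyc_sign i j = - cyc_sign j i.
Proof. by rewrite /cyc_sign opprB. Qed.

Lemma cyc_signD1 i : cyc_sign i (i + 1) = 1.
Proof.
by rewrite /cyc_sign eqxx; case: i => [[|[|[|]]]] //= ?; rewrite subr0.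
Qed.

Lemma cyc_signD2 i : cyc_sign i (i + 1 + 1) = -1.
Proof. by rewrite cyc_signC -{2}(ord3D1 i) cyc_signD1. Qed.

End CyclicSign.

(** * Structure constants of a three-dimensional eigenbasis *)

Section Dimension3.
Variables (K : fieldType) (g : lieAlgType K) (z : 3.-tuple g).
Hypotheses (zb : basis_of fullv z) (g_perfect : perfect g).

(** The [p i] are the values of a linear form on the basis. It kills the brackets of cyclic
    neighbours, hence all brackets by antisymmetry and bilinearity. *)
Lemma perfect_basis_form (a b p : 'I_3 -> K) :
    (forall i, lie (tnth z i) (tnth z (i + 1)) =
               a i *: tnth z i + b i *: tnth z (i + 1)) ->
    (forall i, p i * a i + p (i + 1) * b i = 0) ->
  forall i, p i = 0.
Proof.
move=> zz pab.
pose phi (x : g) : K^o := \sum_i coord z i x * p i.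
have phi_lin : linear phi.
  move=> c x y; rewrite /phi scaler_sumr -big_split /=.
  by apply: eq_bigr => i _; rewrite linearP /= mulrDl -mulrA.
pose Lphi := HB.pack_for {linear g -> K^o} phi
  (GRing.isLinear.Build K g K^o *:%R phi phi_lin).
have phiz i : Lphi (tnth z i) = p i.
  rewrite /= /phi (bigD1 i) //= coord_tnth // eqxx mul1r big1 ?addr0 // => j ji.
  by rewrite coord_tnth // eq_sym (negPf ji) mul0r.
move=> i; rewrite -phiz; apply: g_perfect => x y.
rewrite (lie_coordE x y zb) linear_sum big1 // => j _.
rewrite linear_sum big1 // => k _; rewrite linearZ.
suff -> : Lphi (lie (tnth z j) (tnth z k)) = 0 by exact: mulr0.
move: j k; apply: ord3_pair_ind => [j|j k jk|j].
- by rewrite liexx linear0.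
- by rewrite lieC linearN jk oppr0.
- rewrite zz linearD !linearZ !phiz /= -[RHS](pab j).
  by rewrite ![p _ * _]mulrC.
Qed.

(** Compare the coefficients of z_i in Jacobi's identity for z_i, z_(i+1), z_(i+2): the two terms
    a_i b_(i+2) cancel. *)
Lemma lie_jacobi_coef (a b : 'I_3 -> K) :
    (forall i, lie (tnth z i) (tnth z (i + 1)) =
               a i *: tnth z i + b i *: tnth z (i + 1)) ->
  forall i, a i * a (i + 1) = b (i + 1) * b (i + 1 + 1).
Proof.
move=> zz i; pose j := i + 1; pose k := i + 1 + 1.
have zij := zz i; have zjk := zz j; have zki := zz k.
rewrite -/j -/k ord3D1 in zij zjk zki *.
have := lie_jacobi (tnth z i) (tnth z j) (tnth z k).
rewrite zij zjk zki !linearD !linearZ /=.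
rewrite [lie (tnth z i) (tnth z k)]lieC [lie (tnth z j) (tnth z i)]lieC.
rewrite [lie (tnth z k) (tnth z j)]lieC zij zjk zki.
move/(congr1 (coord z i)).
rewrite !(linearD, linearN, linearZ_LR) /= !coord_tnth // linear0 eqxx.
rewrite (negPf (ord3D1_neq i)) (negPf (ord3D2_neq i)) => e.
apply/eqP; rewrite -subr_eq0 -[X in _ == X]e.
by apply/eqP => /=; ring.
Qed.

Lemma nijenhuis_eigenbasis3P : nijenhuis_eigenbasis z ->
  exists2 m : 'I_3 -> K, (forall i, m i != 0) &
    forall i j, lie (tnth z i) (tnth z j) =
      cyc_sign K i j *: (m j *: tnth z i + m i *: tnth z j).
Proof.
move=> [_ zspan].
have ex_ab i : exists ab : K * K, lie (tnth z i) (tnth z (i + 1)) ==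
    ab.1 *: tnth z i + ab.2 *: tnth z (i + 1).
  have := zspan i (i + 1); rewrite span_cons span_seq1.
  case/memv_addP => _ /vlineP[c ->] [_ /vlineP[d ->]] ->.
  by exists (c, d).
pose a i := (xchoose (ex_ab i)).1; pose b i := (xchoose (ex_ab i)).2.
have zz i : lie (tnth z i) (tnth z (i + 1)) =
    a i *: tnth z i + b i *: tnth z (i + 1).
  exact/eqP/(xchooseP (ex_ab i)).
have jac := lie_jacobi_coef zz.
(* b i - a (i + 2) is the trace of ad z_i. *)
have trace0 : forall i, b i - a (i + 1 + 1) = 0.
  apply: (perfect_basis_form zz) => i.
  (* Once a_i b_i cancels, what remains is b_i b_(i+1) - a_(i+2) a_i, which is zero by this instance
     of Jacobi. *)
  have := jac (i + 1 + 1); rewrite ord3D1 => j3.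
  by rewrite !mulrBl j3; ring.
have aE i : a i = b (i + 1).
  by apply/eqP; rewrite eq_sym -subr_eq0 -{2}(ord3D1 i) trace0.
exists b; last first.
  apply: ord3_pair_ind => [i|i j ij|i].
  - by rewrite liexx cyc_sign_refl scale0r.
  - by rewrite lieC ij cyc_signC scaleNr opprK addrC.
  - by rewrite cyc_signD1 scale1r zz aE.
move=> i; apply/eqP => bi0.
(* If b_i = 0, the form with values 0, b_(i+1), -b_(i+2) on z_i, z_(i+1), z_(i+2) kills every
   bracket. *)
have sb0 : forall j, cyc_sign K i j * b j = 0.
  apply: (perfect_basis_form zz) => j; rewrite aE.
  case/or3P: (ord3_cases i j) => /eqP->.
  - by rewrite bi0 !mulr0 mul0r addr0.
  - by rewrite cyc_signD1 cyc_signD2; ring.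
  - by rewrite ord3D1 bi0 !mulr0 mul0r addr0.
have b0 j : b j = 0.
  case/or3P: (ord3_cases i j) => /eqP-> //.
  - by have := sb0 (i + 1); rewrite cyc_signD1 mul1r.
  - by have /eqP := sb0 (i + 1 + 1); rewrite cyc_signD2 mulN1r oppr_eq0 => /eqP.
(* The bracket now vanishes identically, so even the form equal to 1 on each basis vector must be
   zero. *)
have /eqP : (1 : K) = 0.
  apply: (perfect_basis_form (p := fun=> 1) zz _ 0) => j.
  by rewrite aE !b0 !mulr0 addr0.
by rewrite oner_eq0.
Qed.

End Dimension3.

Lemma perfect_equivalent_eigenbases (K : fieldType) (g : lieAlgType K)
    (z z' : 3.-tuple g) :
    perfect g -> nijenhuis_eigenbasis z -> nijenhuis_eigenbasis z' ->
  equivalent_eigenbases z z'.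
Proof.
move=> gP zN z'N; have [zb _] := zN; have [z'b _] := z'N.
have [m m0 zz] := nijenhuis_eigenbasis3P zb gP zN.
have [m' m'0 zz'] := nijenhuis_eigenbasis3P z'b gP z'N.
(* [Phi] is to send z_i / m_i to z'_i / m'_i, which forces this factor. *)
pose nu i := m i / m' i.
have nu0 i : nu i != 0 by rewrite mulf_neq0 ?invr_eq0.
pose Phi := basis_map z (fun i => nu i *: tnth z' i).
have PhiE i : Phi (tnth z i) = nu i *: tnth z' i by rewrite basis_map_tnth.
exists (fun i => (nu i)^-1), Phi; split=> [i||i].
- by rewrite invr_eq0.
- split.
    exists (basis_map z' (fun i => (nu i)^-1 *: tnth z i)).
      by apply: basis_mapK => // i; rewrite divff.
    by apply: basis_mapK => // i; rewrite mulVf.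
  apply: (lie_morph_on_basis zb) => i j /=.
  (* Both sides carry the same [cyc_sign]; the coefficients agree because [nu j * m' j = m j]. *)
  rewrite !PhiE lieZl linearZ /= zz zz' !linearZ /= linearD !linearZ /= !PhiE.
  rewrite !scalerDr !scalerA /nu.
  by congr (_ *: _ + _ *: _); field; rewrite ?m'0.
- by rewrite PhiE scalerA mulVf // scale1r.
Qed.

(** * Perfectness of sl(2) when 2 is invertible *)

Section SL2.
Variable K : fieldType.

(** The element aH + bE + cF for the standard triple H, E, F. *)
Definition sl2_mx (a b c : K) : 'M[K]_2 :=
  \matrix_(i, j) if i == j then if i == 0 then a else - a
                 else if i == 0 then b else c.

Lemma sl2_mx_traceless a b c : sl2_mx a b c \in traceless 2 K.
Proof.
by rewrite mem_traceless /mxtrace !big_ord_recl big_ord0 !mxE /= addr0 subrr.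
Qed.

Definition sl2 a b c : sl 2 K := Subvs (sl2_mx_traceless a b c).

Lemma sl2E (x : sl 2 K) : exists a b c, x = sl2 a b c.
Proof.
exists (vsval x 0 0), (vsval x 0 1), (vsval x 1 0); apply: val_inj => /=.
have := valP x; rewrite mem_traceless /mxtrace !big_ord_recl big_ord0 addr0.
rewrite addrC addr_eq0 => /eqP tr0.
have l0 : lift ord0 ord0 = 1 :> 'I_2 by apply/eqP.
apply/matrixP => i j; rewrite !mxE.
case: i j => [[|[|]] //= hi] [[|[|]] //= hj]; rewrite -?tr0 ?l0;
  by congr (_ _ _); apply/eqP.
Qed.

Lemma lie_sl2 a b c a' b' c' :
  lie (sl2 a b c) (sl2 a' b' c') =
  sl2 (b * c' - b' * c) (2 * (a * b' - a' * b)) (2 * (c * a' - c' * a)).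
Proof.
apply: val_inj; rewrite /= /mxcomm; apply/matrixP => i j.
rewrite !mxE !big_ord_recl !big_ord0 !mxE.
by case: i j => [[|[|]] //= hi] [[|[|]] //= hj]; ring.
Qed.

Lemma sl2_perfect : 2 != 0 :> K -> perfect (sl 2 K).
Proof.
move=> two phi phi0 x; have [a [b [c ->]]] := sl2E x.
(* Here [aE, F] = aH and [H/2, bE - cF] = bE + cF, as E and F have weights 2 and -2 under ad H. *)
have -> : sl2 a b c = lie (sl2 0 a 0) (sl2 0 0 1)
    + lie (sl2 (1 / 2) 0 0) (sl2 0 b (- c)).
  rewrite !lie_sl2; apply: val_inj => /=; apply/matrixP => i j; rewrite !mxE.
  by case: i j => [[|[|]] //= hi] [[|[|]] //= hj]; field.
by rewrite linearD !phi0 addr0.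
Qed.

End SL2.

Theorem mainTheorem5 (R : realType) :
  (forall zeta zeta' : 3.-tuple (sl 2 R),
     nijenhuis_eigenbasis zeta -> nijenhuis_eigenbasis zeta' ->
     equivalent_eigenbases zeta zeta') /\
  (forall zeta zeta' : 3.-tuple (sl 2 R[i]),
     nijenhuis_eigenbasis zeta -> nijenhuis_eigenbasis zeta' ->
     equivalent_eigenbases zeta zeta').
Proof.
split=> zeta zeta'; apply: perfect_equivalent_eigenbases; apply: sl2_perfect.
all: by rewrite pnatr_eq0.
Qed.
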